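(* Consider the fresh gradient setting with cost functions $f_t:[0,1]\to[0,\infty)$ that are convex, $M$-smooth and satisfy $\min_{x\in[0,1]}f_t(x)=0$. Then any online algorithm $\mathcal A$ has competitive ratio at least $\Omega(M)$; that is, there are absolute constants $c>0$ and $M_0$ such that for every $M\ge M_0$ and every online algorithm $\mathcal A$ one has $\mu_{\mathcal A}\ge cM$.
   Context: Problem (online convex optimization with linear switching cost, dimension one). An input $\sigma$ consists of a horizon $T$, a starting point $x_0\in[0,1]$ and cost functions $f_1,\dots,f_T:[0,1]\to[0,\infty)$. Choosing actions $x_1,\dots,x_T\in[0,1]$ costs $\sum_{t=1}^T\big(f_t(x_t)+|x_t-x_{t-1}|\big)$. $C_{\mathcal A}(\sigma)$ is the cost of the online algorithm $\mathcal A$ on $\sigma$, and $C_{OPT}(\sigma)$ is the minimum of the cost over all action sequences in $[0,1]$ with the same starting point $x_0$ (the whole input being known in advance). The competitive ratio is $\mu_{\mathcal A}=\max_\sigma C_{\mathcal A}(\sigma)/C_{OPT}(\sigma)$ (understood as a supremum), over all inputs satisfying the stated assumptions. Smoothness: $f$ is $M$-smooth if it is differentiable on $[0,1]$ (one-sidedly at the endpoints) with $M$-Lipschitz derivative $\nabla f$. Fresh gradient setting: an online algorithm chooses $x_t\in[0,1]$ as a function only of $x_0$ and the information $\{f_i(x_{i-1}),\nabla f_i(x_{i-1}) : i=1,\dots,t\}$ (the class parameter $M$ may be known to it). *)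

(* Defs.v *)
From HB Require Import structures.
From mathcomp Require Import all_boot all_order all_algebra.
From mathcomp Require Import all_classical all_reals all_analysis.

Set Implicit Arguments.
Unset Strict Implicit.
Unset Printing Implicit Defensive.

Import Order.TTheory GRing.Theory Num.Theory.
Import numFieldNormedType.Exports.

Local Open Scope classical_set_scope.
Local Open Scope ring_scope.

(* Functions on [0, 1] are represented by total
   functions R -> R of which only the values on [0, 1] are ever used. *)

Section Smoothness.
Variable R : realType.
Implicit Types (f : R -> R) (x M : R).

(* y ranges over [0, 1] \ {x}, hence the derivative is one-sided at 0 and 1 *)
Definition diff_quotient01 f x : set_system R :=
  (fun y : R => (f y - f x) / (y - x)) @ within `[0, 1] x^'.

Definition differentiable01 f : Prop :=
  forall x, x \in `[0, 1] -> cvg (diff_quotient01 f x).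

Definition grad01 f x : R := lim (diff_quotient01 f x).

Definition smooth01 M f : Prop :=
  differentiable01 f /\ M.-lipschitz_`[0, 1] (grad01 f).

Definition admissible_cost M f : Prop :=
  [/\ forall x, x \in `[0, 1] -> 0 <= f x,
      exists2 x : R, x \in `[0, 1] & f x = 0,
      convex_function (`[0, 1] : set R) f
    & smooth01 M f].

End Smoothness.

Section OnlineOptimization.
Variable R : realType.

(* Only the cost functions f_t with 1 <= t <= horizon are relevant. *)
Record input := Input {
  horizon : nat;
  start : R;
  cost_fun : nat -> R -> R
}.

Implicit Type s : input.

Definition admissible_input (M : R) s : Prop :=
  [/\ (0 < horizon s)%N,
      start s \in `[0, 1]
    & forall t, (1 <= t <= horizon s)%N -> admissible_cost M (cost_fun s t)].

Definition total_cost s (x : nat -> R) : R :=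
  \sum_(1 <= t < (horizon s).+1) (cost_fun s t (x t) + `|x t - x t.-1|).

Definition feasible s (x : nat -> R) : Prop :=
  x 0%N = start s /\
  forall t, (1 <= t <= horizon s)%N -> x t \in `[0, 1].

(* For admissible inputs the costs are continuous, so that by compactness of
   [0, 1]^T this infimum is a minimum. *)
Definition opt_cost s : R := inf [set total_cost s x | x in feasible s].

(* An online algorithm maps x_0 and the nonempty list of the pairs
   (f_i(x_{i-1}), grad f_i(x_{i-1})), i = 1, ..., t, to the action x_t. *)
Definition algorithm := R -> seq (R * R) -> R.

Implicit Type A : algorithm.

Definition online_algorithm A : Prop :=
  forall (x0 : R) h, x0 \in `[0, 1] -> A x0 h \in `[0, 1].

Definition position A (x0 : R) (h : seq (R * R)) : R :=
  if nilp h then x0 else A x0 h.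

Fixpoint feedback A s (t : nat) : seq (R * R) :=
  if t is u.+1 then
    let h := feedback A s u in
    let x := position A (start s) h in
    rcons h (cost_fun s t x, grad01 (cost_fun s t) x)
  else [::].

Definition actions A s (t : nat) : R := position A (start s) (feedback A s t).

Definition alg_cost A s : R := total_cost s (actions A s).

(* The quotient is the one of \bar R, where a / 0 = +oo for 0 < a and
   0 / 0 = 0: an input with C_A = C_OPT = 0 does not constrain the ratio. *)
Definition competitive_ratio (M : R) A : \bar R :=
  ereal_sup [set ((alg_cost A s)%:E / (opt_cost s)%:E)%E |
             s in admissible_input M].

End OnlineOptimization.

(* Main.v *)
(** One round starting at 0 suffices. With K = M / 6, the costs
    K (1 - 3x/2)^2 and K (1 - x)^3 are both M-smooth and convex, and they have
    the same value K and the same slope - 3K at 0, so the algorithm plays the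
    same point y against both. They vanish at the distinct points 2/3 and 1:
    if y >= 5/6 the first cost is at least K/16, otherwise the second one is at
    least K/216, while the optimum moves to the zero and pays at most 1. *)

Require Import Defs.
From mathcomp Require Import all_boot all_order all_algebra.
From mathcomp Require Import all_classical all_reals all_analysis.
From mathcomp Require Import ring lra.

Set Implicit Arguments.
Unset Strict Implicit.
Unset Printing Implicit Defensive.

Import Order.TTheory GRing.Theory Num.Theory.
Import numFieldNormedType.Exports.

Local Open Scope ring_scope.

(** Properness makes limits along this filter unique, so that the [lim] in [grad01] can be computed,
    at the endpoints too. *)
Lemma within01_dnbhs_proper (R : realType) (x : R) :
  x \in `[0, 1] -> ProperFilter (within `[0, 1]%classic x^'%classic).
Proof.
rewrite in_itv/= => /andP[x0 x1].
apply: Build_ProperFilter_ex => A /nbhs_ballP[e /= e0 Ae].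
suff [y [yx xye y01]] : exists y : R, [/\ y != x, `|x - y| < e & 0 <= y <= 1].
  by exists y; apply: Ae.
(* Moving by at most 1/2 towards the farther endpoint stays in [0, 1]. *)
have [xh|xh] := leP x 2^-1.
  exists (x + Num.min (e / 2) 2^-1).
  by rewrite minEle; case: ifP => eh; split;
    rewrite ?opprD ?addNKr ?normrN ?ger0_norm; lra.
exists (x - Num.min (e / 2) 2^-1).
by rewrite minEle; case: ifP => eh; split;
  rewrite ?opprB ?[x + _]addrC ?subrK ?ger0_norm; lra.
Qed.

(** Carathéodory's slope function is continuous at [x] and equals the difference quotient elsewhere;
    restricting to [0, 1] keeps the limit. *)
Lemma diff_quotient01_cvg (R : realType) (f : R -> R) (x d : R) :
  is_derive x 1 f d -> (diff_quotient01 f x --> d)%classic.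
Proof.
move=> /is_derive1_caratheodory[g [fE gx <-]].
apply: cvg_within_filter.
move/continuous_withinNx : gx; apply: cvg_trans.
apply: near_eq_cvg; near=> y.
by rewrite fE mulfK// subr_eq0; near: y; exact: nbhs_dnbhs_neq.
Unshelve. all: by end_near. Qed.

Lemma grad01E (R : realType) (f : R -> R) (x d : R) :
  x \in `[0, 1] -> is_derive x 1 f d -> grad01 f x = d.
Proof.
move=> x01 fd; have ? := @within01_dnbhs_proper R x x01.
by apply: cvg_lim => //; exact: diff_quotient01_cvg.
Qed.

Lemma smooth01_is_derive (R : realType) (M : R) (f f' : R -> R) :
  (forall x : R, is_derive x 1 f (f' x)) ->
  (forall x y : R, x \in `[0, 1] -> y \in `[0, 1] ->
    `|f' x - f' y| <= M * `|x - y|) ->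
  smooth01 M f.
Proof.
move=> ff' lip; split=> [x x01|].
  by apply/cvg_ex; exists (f' x); exact: diff_quotient01_cvg.
move=> [x y] /= [x01 y01].
by rewrite (@grad01E _ _ _ (f' x))// (@grad01E _ _ _ (f' y))//; exact: lip.
Qed.

(** The factor 3/2 gives slope - 2 * (3/2) * K = - 3K at 0, matching the cube in [late_cost]. *)
Definition early_cost {R : realType} (K x : R) : R :=
  K * (1 - 3 / 2 * x) ^+ 2.

Definition late_cost {R : realType} (K x : R) : R := K * (1 - x) ^+ 3.

Lemma is_derive_early_cost (R : realType) (K x : R) :
  is_derive x 1 (early_cost K) (K * (9 / 2 * x - 3)).
Proof.
have -> : early_cost K = horner (K *: (1 - (3 / 2) *: 'X) ^+ 2).
  by apply/funext => y; rewrite /early_cost !hornerE.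
apply: is_derive_eq.
by rewrite !poly.derivE !hornerE /=; field.
Qed.

Lemma is_derive_late_cost (R : realType) (K x : R) :
  is_derive x 1 (late_cost K) (- (3 * K) * (1 - x) ^+ 2).
Proof.
have -> : late_cost K = horner (K *: (1 - 'X) ^+ 3).
  by apply/funext => y; rewrite /late_cost !hornerE.
apply: is_derive_eq.
by rewrite !poly.derivE !hornerE /=; field.
Qed.

Lemma admissible_early_cost (R : realType) (K : R) :
  0 <= K -> admissible_cost (6 * K) (early_cost K).
Proof.
move=> K0; split.
- by move=> x _; rewrite mulr_ge0// sqr_ge0.
- by exists (2 / 3); [rewrite in_itv/=; lra|rewrite /early_cost; field].
- move=> t x y _ _; rewrite convRE [X in early_cost K X]convRE
    /unstable.onem /early_cost.
  have t0 : 0 <= t%:num by []. have t1 : t%:num <= 1 by [].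
  move: (t%:num) t0 t1 => s s0 s1.
  (* The convexity gap of the square of an affine function, in closed form. *)
  rewrite -subr_ge0 (_ : _ - _ = K * (s * (1 - s)) * (3 / 2 * (x - y)) ^+ 2).
    by rewrite mulr_ge0 ?sqr_ge0// !mulr_ge0// subr_ge0.
  by field.
- apply: (smooth01_is_derive (is_derive_early_cost K)) => x y _ _.
  rewrite (_ : _ - _ = 9 / 2 * K * (x - y)); last by field.
  by rewrite normrM ger0_norm ?ler_wpM2r//; lra.
Qed.

Lemma admissible_late_cost (R : realType) (K : R) :
  0 <= K -> admissible_cost (6 * K) (late_cost K).
Proof.
move=> K0; split.
- by move=> x; rewrite in_itv/= => x01; rewrite mulr_ge0// exprn_ge0//; lra.
- by exists 1; [rewrite in_itv/=; lra|rewrite /late_cost; ring].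
- move=> t x y; rewrite !inE/= !in_itv/= => x01 y01.
  rewrite convRE [X in late_cost K X]convRE /unstable.onem /late_cost.
  have t0 : 0 <= t%:num by []. have t1 : t%:num <= 1 by [].
  move: (t%:num) t0 t1 => s s0 s1.
  (* The convexity gap of the cube; its last factor is nonnegative because [x] and [y] are at most
     1. *)
  rewrite -subr_ge0 (_ : _ - _ = K * (s * (1 - s)) * (x - y) ^+ 2 *
    ((1 + s) * (1 - x) + (2 - s) * (1 - y))); last by ring.
  apply: mulr_ge0; last by apply: addr_ge0; apply: mulr_ge0; lra.
  by apply: mulr_ge0 (sqr_ge0 _); rewrite !mulr_ge0 ?subr_ge0.
- apply: (smooth01_is_derive (is_derive_late_cost K)) => x y.
  rewrite !in_itv/= => x01 y01.
  (* Since 2 - x - y <= 2 on [0, 1], the Lipschitz constant is 6K, whence the choice K = M / 6. *)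
  rewrite (_ : _ - _ = 3 * K * (2 - x - y) * (x - y)); last by ring.
  rewrite normrM ler_wpM2r// ger0_norm; last by rewrite !mulr_ge0//; lra.
  rewrite (_ : 6 * K = 3 * K * 2); last by ring.
  by rewrite ler_wpM2l//; lra.
Qed.

Definition single_round {R : realType} (f : R -> R) : input R :=
  Input 1 0 (fun _ => f).

Lemma admissible_single_round (R : realType) (M : R) (f : R -> R) :
  admissible_cost M f -> admissible_input M (single_round f).
Proof. by split=> //; rewrite in_itv/= lexx ler01. Qed.

Lemma total_cost_single_round (R : realType) (f : R -> R) (x : nat -> R) :
  total_cost (single_round f) x = f (x 1) + `|x 1 - x 0|.
Proof. by rewrite /total_cost big_nat1. Qed.

(** The only feedback before the action is taken at the starting point 0, so the action sees [f]
    only through its value and slope there. *)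
Lemma actions_single_round (R : realType) (A : algorithm R) (f : R -> R) :
  actions A (single_round f) 1 = A 0 [:: (f 0, grad01 f 0)].
Proof. by []. Qed.

Lemma alg_cost_single_round_ge (R : realType) (A : algorithm R) (f : R -> R) :
  f (actions A (single_round f) 1) <= alg_cost A (single_round f).
Proof. by rewrite /alg_cost total_cost_single_round lerDl. Qed.

Lemma opt_cost_single_round (R : realType) (f : R -> R) :
  (forall x, x \in `[0, 1] -> 0 <= f x) ->
  (exists2 x : R, x \in `[0, 1] & f x = 0) ->
  0 <= opt_cost (single_round f) <= 1.
Proof.
move=> f0 [z z01 fz].
have lb : lbound [set total_cost (single_round f) x |
                    x in feasible (single_round f)]%classic 0.
  move=> _ [x [_ xf] <-]; rewrite total_cost_single_round addr_ge0// f0//.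
  exact: xf.
(* Jumping straight to the zero [z] of [f] costs only the movement, at most 1. *)
pose x t : R := if t is 0%N then 0 else z.
have fx : feasible (single_round f) x by split => // -[|t].
apply/andP; split.
  by apply: lb_le_inf => //; exists (total_cost (single_round f) x), x.
apply: (@le_trans _ _ (total_cost (single_round f) x)).
  by apply: ge_inf; [exists 0|exists x].
rewrite total_cost_single_round /= fz add0r subr0.
by move: z01; rewrite in_itv/= => /andP[z0 z1]; rewrite ger0_norm.
Qed.

(** Dividing by an optimum in ]0, 1] cannot decrease the cost; if the optimum is 0, the quotient is
    +oo because the cost is positive. *)
Lemma le_competitive_ratio (R : realType) (M a : R) (A : algorithm R)
    (s : input R) :
  admissible_input M s -> 0 <= opt_cost s <= 1 -> 0 < a -> a <= alg_cost A s ->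
  (a%:E <= competitive_ratio M A)%E.
Proof.
move=> sM /andP[ opt0 opt1] a0 aA.
apply: (@le_trans _ _ ((alg_cost A s)%:E / (opt_cost s)%:E)%E); last first.
  by apply: ereal_sup_ubound; exists s.
have A0 : 0 < alg_cost A s by exact: lt_le_trans aA.
rewrite inver; case: eqP => [_|/eqP on0].
  by rewrite gt0_muley ?leey// lte_fin.
have op : 0 < opt_cost s by rewrite lt_neqAle eq_sym on0.
rewrite -EFinM lee_fin ler_pdivlMr//.
by apply: le_trans aA; rewrite ler_piMr// ltW.
Qed.

Theorem theorem2 (R : realType) :
  exists c M0 : R, 0 < c /\
    forall M : R, M0 <= M ->
    forall A : algorithm R, online_algorithm A ->
    ((c * M)%:E <= competitive_ratio M A)%E.
Proof.
(* One factor 1/6 comes from K = M / 6, the other three from (1 - 5/6)^3; the bound 1 on [M] ensures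
   positivity. *)
exists (6^-1 ^+ 4), 1; split=> [|M M1 A onA].
  by rewrite exprn_gt0// invr_gt0.
pose K := M / 6; have K0 : 0 <= K by rewrite /K; lra.
have MK : M = 6 * K by rewrite /K; field.
have cM0 : 0 < 6^-1 ^+ 4 * M.
  by rewrite mulr_gt0 ?exprn_gt0 ?invr_gt0//; lra.
have zero01 : (0 : R) \in `[0, 1] by rewrite in_itv/= lexx ler01.
have same_feedback : (early_cost K 0, grad01 (early_cost K) 0) =
                     (late_cost K 0, grad01 (late_cost K) 0).
  rewrite (grad01E zero01 (is_derive_early_cost K 0)).
  rewrite (grad01E zero01 (is_derive_late_cost K 0)).
  by congr pair; rewrite /early_cost /late_cost; ring.
pose y := A 0 [:: (late_cost K 0, grad01 (late_cost K) 0)].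
have : y \in `[0, 1] by exact: onA.
rewrite in_itv/= => /andP[y0 y1].
(* 5/6 is the midpoint of the two zeros 2/3 and 1. *)
have [y56|y56] := leP (5 / 6) y.
- have fK := admissible_early_cost K0; have [f0 fz _ _] := fK.
  apply: (@le_competitive_ratio _ _ _ _ (single_round (early_cost K))) => //.
  + by apply: admissible_single_round; rewrite MK.
  + exact: opt_cost_single_round.
  apply: le_trans (alg_cost_single_round_ge _ _).
  rewrite actions_single_round same_feedback -/y /early_cost.
  rewrite (_ : _ * M = K * 6^-1 ^+ 3); last by rewrite MK; field.
  (* Here 3y/2 - 1 >= 1/4, and 1/16 exceeds 1/216. *)
  by rewrite ler_wpM2l//; nra.
- have fK := admissible_late_cost K0; have [f0 fz _ _] := fK.
  apply: (@le_competitive_ratio _ _ _ _ (single_round (late_cost K))) => //.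
  + by apply: admissible_single_round; rewrite MK.
  + exact: opt_cost_single_round.
  apply: le_trans (alg_cost_single_round_ge _ _).
  rewrite actions_single_round -/y /late_cost.
  rewrite (_ : _ * M = K * 6^-1 ^+ 3); last by rewrite MK; field.
  (* Here 1 - y > 1/6, and cubing is monotone on nonnegative reals. *)
  by rewrite ler_wpM2l// lerXn2r ?nnegrE//; lra.
Qed.
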